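(* Let $p$ be a prime, $\Bbbk$ a field of characteristic $p$, $G=\langle\sigma\rangle$ of order $p$ acting on $V=V_2\oplus V_2$ so that on the dual basis $\sigma x_1=x_1+x_3$, $\sigma x_2=x_2+x_4$, $\sigma x_3=x_3$, $\sigma x_4=x_4$. Let $A=\Bbbk[x_1^p-x_1x_3^{p-1},\ x_2^p-x_2x_4^{p-1},\ x_3,\ x_4]$, $u=x_1x_4-x_2x_3$, and $1\le n\le p$. For $k\ge0$ let $M_k=\{x_1^ix_2^j: i+j=k,\ 0\le i<p,\ 0\le j<p\}$, and write $fM_k=\{fm:m\in M_k\}$ and $\Delta^rM_k=\{\Delta^r(m):m\in M_k\}$. Then $K_n=\ker(\Delta^n:\Bbbk[V]\to\Bbbk[V])$ is a free $A$-module with basis $S=M\cup U\cup D$, where \[M=\bigcup_{k=0}^{n-1}M_k,\qquad U=\bigcup_{k=1}^{p-n}u^kM_{n-1},\qquad D=\bigcup_{k=2p-n}^{2p-2}\Delta^{p-n}M_k.\]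
   Context: $\Delta=\sigma-\iota\in\Bbbk G$ acting on $\Bbbk[V]=\Bbbk[x_1,x_2,x_3,x_4]$. *)

(* Defs.v *)
From mathcomp Require Import all_boot all_algebra.
From mathcomp Require Import mpoly.
Set Implicit Arguments. Unset Strict Implicit. Unset Printing Implicit Defensive.
Import GRing.Theory.
Local Open Scope ring_scope.

Section Defs.
Variable k : fieldType.
Notation P := {mpoly k[4]}.

Definition x1 : P := 'X_(0 : 'I_4).
Definition x2 : P := 'X_(1 : 'I_4).
Definition x3 : P := 'X_(2 : 'I_4).
Definition x4 : P := 'X_(3 : 'I_4).

Definition sigma_act (f : P) : P :=
  comp_mpoly [tuple x1 + x3; x2 + x4; x3; x4] f.

Definition Delta (f : P) : P := sigma_act f - f.
Definition Delta_pow (r : nat) (f : P) : P := iter r Delta f.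

Definition in_Kn (n : nat) (f : P) : Prop := Delta_pow n f = 0.

Definition A_gens (p : nat) : 4.-tuple P :=
  [tuple x1 ^+ p - x1 * x3 ^+ p.-1; x2 ^+ p - x2 * x4 ^+ p.-1; x3; x4].
Definition in_A (p : nat) (a : P) : Prop :=
  exists q : P, a = comp_mpoly (A_gens p) q.

Definition u : P := x1 * x4 - x2 * x3.

Definition Mk (p kk : nat) : seq P :=
  [seq x1 ^+ i * x2 ^+ (kk - i) | i <- iota 0 kk.+1 & (i < p)%N && (kk - i < p)%N].

Definition M_part (p n : nat) : seq P := flatten [seq Mk p kk | kk <- iota 0 n].
Definition U_part (p n : nat) : seq P :=
  flatten [seq [seq u ^+ kk * m | m <- Mk p n.-1] | kk <- iota 1 (p - n)].
Definition D_part (p n : nat) : seq P :=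
  flatten [seq [seq Delta_pow (p - n) m | m <- Mk p kk]
          | kk <- iota (2 * p - n) (n - 1)].
(* kk ranges over 2p-n, ..., 2p-2 : that is n-1 values *)

(* S = M ∪ U ∪ D, as a duplicate-free list (i.e. as a set) *)
Definition S_basis (p n : nat) : seq P := undup (M_part p n ++ U_part p n ++ D_part p n).

Definition free_A_basis (p n : nat) (S : seq P) : Prop :=
  [/\ (forall s, s \in S -> in_Kn n s),
      (forall f, in_Kn n f ->
         exists c : nat -> P, (forall i, in_A p (c i)) /\
           f = \sum_(i < size S) c i * S`_i) &
      (forall c : nat -> P, (forall i, in_A p (c i)) ->
         \sum_(i < size S) c i * S`_i = 0 -> forall i, (i < size S)%N -> c i = 0)].
End Defs.

(* Main.v *)
Require Import Defs.
From mathcomp Require Import all_boot all_algebra.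
From mathcomp Require Import mpoly.
From mathcomp Require Import zify ring.
Set Implicit Arguments. Unset Strict Implicit. Unset Printing Implicit Defensive.
Import GRing.Theory.
Local Open Scope ring_scope.

(** Invert [x3]: then [x2 = (x1 x4 - u) / x3] with [u] invariant and [sigma x1 = x1 + x3], so
    [K_n[1/x3]] is free over [A[1/x3]] with basis [T = {x1^i u^j : i < n, j < p}].  The elements of
    [M] and [U] span the [x1^i u^j] with [i + j < p]; for [i + j >= p] the leading term of
    [Delta^(p-n) (x1^(i+p-n) x2^j)], an element of [D], is a unit multiple of [x1^i u^j].  As [S]
    and [T] both have [n p] elements, [S] is a basis after inverting [x3], and by the symmetry
    [x1 <-> x2], [x3 <-> x4] also after inverting [x4]; the coordinates of an element of [K_n] thus
    lie in [A[1/x3]] and in [A[1/x4]], hence in [A]. *)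

(** * Spans over a subring, and denominators that are powers of one element *)

Section Span.

Variables (R : idomainType) (A : R -> Prop).

Definition subring : Prop :=
  [/\ A 1, forall a b, A a -> A b -> A (a - b) & forall a b, A a -> A b -> A (a * b)].

Definition lspan (S : seq R) (f : R) : Prop :=
  exists c : nat -> R, (forall i, A (c i)) /\ f = \sum_(i < size S) c i * S`_i.

(** Coefficients belong to positions of the list, so a repeated entry already counts as a
    dependence. *)
Definition indep (S : seq R) : Prop :=
  forall c : nat -> R, (forall i, A (c i)) ->
    \sum_(i < size S) c i * S`_i = 0 -> forall i, (i < size S)%N -> c i = 0.

Definition submodule (L : R -> Prop) : Prop :=
  [/\ L 0, forall f g, L f -> L g -> L (f + g) & forall a f, A a -> L f -> L (a * f)].

Hypothesis ringA : subring.

Lemma subring1 : A 1. Proof. by case: ringA. Qed.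
Lemma subringB a b : A a -> A b -> A (a - b). Proof. by case: ringA => _ H _; exact: H. Qed.
Lemma subringM a b : A a -> A b -> A (a * b). Proof. by case: ringA => _ _ H; exact: H. Qed.
Lemma subring0 : A 0. Proof. by rewrite -(subrr 1); apply: subringB; exact: subring1. Qed.
Lemma subringN a : A a -> A (- a).
Proof. by move=> Aa; rewrite -sub0r; apply: subringB => //; exact: subring0. Qed.
Lemma subringD a b : A a -> A b -> A (a + b).
Proof. by move=> Aa Ab; rewrite -[b]opprK; apply: subringB => //; exact: subringN. Qed.

Lemma subring_sum (I : Type) (r : seq I) (F : I -> R) :
  (forall i, A (F i)) -> A (\sum_(i <- r) F i).
Proof. by move=> AF; elim/big_ind: _ => //; [exact: subring0 | exact: subringD]. Qed.

Lemma subringX a e : A a -> A (a ^+ e).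
Proof. by move=> Aa; elim: e => [|e IH]; rewrite ?expr0 ?exprS; [exact: subring1 | exact: subringM]. Qed.

Lemma subring_nat m : A m%:R.
Proof. by elim: m => [|m IH]; rewrite ?mulr0n ?mulrS; [exact: subring0 | apply: subringD; first exact: subring1]. Qed.

Section Submodule.
Variables (L : R -> Prop) (subL : submodule L).

Lemma submodule0 : L 0. Proof. by case: subL. Qed.
Lemma submoduleD f g : L f -> L g -> L (f + g). Proof. by case: subL => _ H _; exact: H. Qed.
Lemma submoduleZ a f : A a -> L f -> L (a * f). Proof. by case: subL => _ _ H; exact: H. Qed.
Lemma submoduleN f : L f -> L (- f).
Proof. by move=> Lf; rewrite -mulN1r; apply: submoduleZ => //; apply/subringN/subring1. Qed.
Lemma submoduleB f g : L f -> L g -> L (f - g).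
Proof. by move=> Lf /submoduleN; apply: submoduleD. Qed.
Lemma submodule_sum (I : eqType) (r : seq I) (P : pred I) (F : I -> R) :
  (forall i, P i -> L (F i)) -> L (\sum_(i <- r | P i) F i).
Proof.
by move=> LF; elim/big_ind: _ => //; [exact: submodule0 | exact: submoduleD].
Qed.

(** Serves below as the induction principle for spans: a property stable under [A]-combinations need
    only be checked on the generators. *)
Lemma lspan_submodule S f : {in S, forall s, L s} -> lspan S f -> L f.
Proof.
move=> LS [c [Ac ->]]; apply: submodule_sum => i _.
by apply: submoduleZ => //; apply/LS/mem_nth.
Qed.

End Submodule.

Lemma submodule_lspan S : submodule (lspan S).
Proof.
split=> [|f g [c [Ac ->]] [d [Ad ->]]|a f Aa [c [Ac ->]]].
- exists (fun _ => 0); split=> [i|]; first exact: subring0.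
  by rewrite big1 // => i _; rewrite mul0r.
- exists (fun i => c i + d i); split=> [i|]; first exact: subringD.
  by rewrite -big_split /=; apply: eq_bigr => i _; rewrite mulrDl.
- exists (fun i => a * c i); split=> [i|]; first exact: subringM.
  by rewrite big_distrr /=; apply: eq_bigr => i _; rewrite mulrA.
Qed.

Lemma mem_lspan S s : s \in S -> lspan S s.
Proof.
move=> sS; exists (fun i => (i == index s S)%:R); split=> [i|]; first exact: subring_nat.
have lt_s : (index s S < size S)%N by rewrite index_mem.
rewrite (bigD1 (Ordinal lt_s)) //= eqxx mul1r nth_index // big1 ?addr0 // => i ne_i.
by rewrite -(inj_eq val_inj) /= in ne_i; rewrite (negbTE ne_i) mul0r.
Qed.

(** Equal entries at positions [i] and [j] would give the relation with coefficients [1] and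
    [-1]. *)
Lemma indep_uniq S : indep S -> uniq S.
Proof.
move=> indS; apply/(uniqP 0) => i j; rewrite !inE => lti ltj eq_ij.
apply/eqP/negPn/negP => ne_ij.
pose c m : R := (m == i)%:R - (m == j)%:R.
have Ac m : A (c m) by apply: subringD; last apply: subringN; apply: subring_nat.
have c0 : \sum_(m < size S) c m * S`_m = 0.
  rewrite (bigD1 (Ordinal lti)) // (bigD1 (Ordinal ltj)) /=; last first.
    by rewrite -(inj_eq val_inj) /= eq_sym.
  rewrite /c !eqxx (negbTE ne_ij) eq_sym (negbTE ne_ij) big1.
    by rewrite eq_ij; ring.
  move=> m /andP[]; rewrite -!(inj_eq val_inj) /= => /negbTE-> /negbTE->.
  by rewrite subrr mul0r.
have := indS c Ac c0 i lti.
by rewrite /c eqxx (negbTE ne_ij) subr0 => /eqP; rewrite oner_eq0.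
Qed.

Section Localization.
Variables (x : R) (Ax : A x).

(** Membership in the localization [L[1/x]], phrased inside [R] so that no fractions are needed. *)
Definition locally (L : R -> Prop) (f : R) : Prop := exists e, L (x ^+ e * f).

Lemma submodule_locally L : submodule L -> submodule (locally L).
Proof.
move=> subL; split=> [|f g [d Lf] [e Lg]|a f Aa [e Lf]].
- by exists 0%N; rewrite mulr0; apply: submodule0.
- exists (d + e)%N; rewrite (_ : _ * _ = x ^+ e * (x ^+ d * f) + x ^+ d * (x ^+ e * g)).
    by apply: submoduleD => //; apply: submoduleZ => //; apply: subringX.
  by rewrite exprD; ring.
- by exists e; rewrite mulrCA; apply: submoduleZ.
Qed.

Lemma locally_intro (L : R -> Prop) f : L f -> locally L f.
Proof. by move=> Lf; exists 0%N; rewrite expr0 mul1r. Qed.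

Lemma locally_div L e f : locally L (x ^+ e * f) -> locally L f.
Proof. by case=> d Lf; exists (d + e)%N; rewrite exprD -mulrA. Qed.

Lemma locally_uniform L (S : seq R) : submodule L ->
  {in S, forall s, locally L s} -> exists e, {in S, forall s, L (x ^+ e * s)}.
Proof.
move=> subL; elim: S => [|s S IH] LS; first by exists 0%N.
have [e LSe] := IH (fun t tS => LS t (mem_behead (s := s :: S) tS)).
have [d Lsd] := LS s (mem_head _ _).
exists (d + e)%N => t; rewrite inE => /predU1P[->|/LSe Lt].
  by rewrite addnC exprD -mulrA; apply: submoduleZ => //; apply: subringX.
by rewrite exprD -mulrA; apply: submoduleZ => //; apply: subringX.
Qed.

End Localization.

End Span.

(** * Independence passes between two families of equal size that span each other locally *)

Section IndepTransfer.

Variables (R : idomainType) (A : R -> Prop) (ringA : subring A).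

(* If [x^d T = Q S] and [x^e S = P T], then [Q P = x^(d+e)] as [T] is free, so [P] is regular. *)
Lemma indep_transfer (S T : seq R) (x : R) : A x -> x != 0 -> size S = size T ->
  indep A T ->
  {in T, forall t, locally x (lspan A S) t} -> {in S, forall s, locally x (lspan A T) s} ->
  indep A S.
Proof.
move=> Ax x0 sizeS indT TS ST.
have [d TSd] := locally_uniform ringA Ax (submodule_lspan ringA S) TS.
have [e STe] := locally_uniform ringA Ax (submodule_lspan ringA T) ST.
pose N := size S.
have coefs (U V : seq R) m : size U = N -> size V = N ->
    {in U, forall w, lspan A V (x ^+ m * w)} ->
    exists Q : 'M[R]_N, (forall i j, A (Q i j)) /\
      forall i : 'I_N, x ^+ m * U`_i = \sum_(j < N) Q i j * V`_j.
  move=> sU sV UV.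
  have /fin_all_exists[c cP] (i : 'I_N) : exists c : nat -> R,
    (forall j, A (c j)) /\ x ^+ m * U`_i = \sum_(j < N) c j * V`_j.
    have [|c [Ac ->]] := UV U`_i; first by rewrite mem_nth ?sU.
    by exists c; split=> //; rewrite sV.
  exists (\matrix_(i, j) c i j); split=> [i j|i]; first by rewrite mxE; case: (cP i).
  by case: (cP i) => _ ->; apply: eq_bigr => j _; rewrite mxE.
have [Q [AQ QP]] := coefs _ _ _ (esym sizeS) erefl TSd.
have [P [AP PP]] := coefs _ _ _ erefl (esym sizeS) STe.
(* Coefficients given on ordinals are extended by [0] beyond [N] to fit [indep]. *)
have indT' (c : 'I_N -> R) : (forall i, A (c i)) -> \sum_(i < N) c i * T`_i = 0 -> c =1 fun=> 0.
  move=> Ac c0 i; pose c' m := oapp c 0 (insub m).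
  have c'E (j : 'I_N) : c' j = c j by rewrite /c' valK.
  rewrite -c'E; apply: indT; last by rewrite -sizeS.
    by move=> m; rewrite /c'; case: insub => [j|] //=; exact: subring0.
  by rewrite -sizeS -[RHS]c0; apply: eq_bigr => j _; rewrite c'E.
have QPE : Q *m P = (x ^+ (d + e))%:M.
  apply/matrixP => i l; apply/eqP; rewrite -subr_eq0; apply/eqP.
  pose c l := (Q *m P) i l - (x ^+ (d + e))%:M i l.
  apply: (indT' c) => [m|].
    apply: subringB => //; first by rewrite mxE; apply: subring_sum => // j; apply: subringM.
    by rewrite mxE -mulr_natr; apply: subringM => //; [apply: subringX | apply: subring_nat].
  rewrite /c; under eq_bigr do rewrite mulrBl.
  rewrite sumrB [X in _ - X](bigD1 i) //= [X in _ - (_ + X)]big1 => [|m ne_mi]; last first.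
    by rewrite mxE eq_sym (negbTE ne_mi) mulr0n mul0r.
  rewrite mxE eqxx mulr1n addr0 addnC exprD -mulrA QP big_distrr /=.
  apply/eqP; rewrite subr_eq0; apply/eqP.
  under eq_bigr do rewrite mxE big_distrl /=.
  rewrite exchange_big /=; apply: eq_bigr => j _.
  by rewrite mulrCA PP big_distrr /=; apply: eq_bigr => m _; rewrite mulrA.
have detP : \det P != 0.
  have := congr1 (fun M : 'M_N => \det M) QPE; rewrite det_mulmx det_scalar => detE.
  have : \det Q * \det P != 0 by rewrite detE !expf_neq0.
  by rewrite mulf_eq0 negb_or => /andP[].
move=> c Ac cS i lti.
pose r : 'rV[R]_N := \row_j c j.
have rP : r *m P = 0.
  apply/rowP => l; rewrite [RHS]mxE; apply: (indT' (fun l => (r *m P) 0 l)) => [m|].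
    by rewrite mxE; apply: subring_sum => // j; apply: subringM => //; rewrite mxE.
  have /= := congr1 ( *%R (x ^+ e)) cS; rewrite mulr0 big_distrr /=; apply: etrans.
  under eq_bigr do rewrite mxE big_distrl /=.
  rewrite exchange_big /=; apply: eq_bigr => j _.
  by rewrite mulrCA PP big_distrr /=; apply: eq_bigr => m _; rewrite mxE mulrA.
(* The adjugate replaces the inverse of [P], which need not have entries in [R]. *)
have : r *m (\det P)%:M = 0 by rewrite -mul_mx_adj mulmxA rP mul0mx.
rewrite mul_mx_scalar => /rowP/(_ (Ordinal lti)); rewrite !mxE => /eqP.
by rewrite mulf_eq0 (negbTE detP) => /eqP.
Qed.

End IndepTransfer.

(** * The operator [sigma - 1] and its effect on powers of a translated element *)

Section DifferenceOperator.

Variables (R : idomainType) (sigma : {rmorphism R -> R}).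

Definition diff (f : R) : R := sigma f - f.

Lemma iter_diffD r f g : iter r diff (f + g) = iter r diff f + iter r diff g.
Proof. by elim: r => //= r ->; rewrite /diff rmorphD; ring. Qed.

Lemma iter_diffZ r a f : sigma a = a -> iter r diff (a * f) = a * iter r diff f.
Proof. by move=> fix_a; elim: r => //= r ->; rewrite /diff rmorphM fix_a mulrBr. Qed.

Lemma iter_diff0 r : iter r diff 0 = 0.
Proof. by rewrite -[X in iter r diff X](mul0r 0) iter_diffZ ?mul0r ?rmorph0. Qed.

Lemma iter_diff_sum r (I : Type) (s : seq I) (P : pred I) (F : I -> R) :
  iter r diff (\sum_(i <- s | P i) F i) = \sum_(i <- s | P i) iter r diff (F i).
Proof. by elim/big_rec2: _ => [|i f g _ <-]; rewrite ?iter_diff0 ?iter_diffD. Qed.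

Lemma iter_diff_eq0 r s f : (r <= s)%N -> iter r diff f = 0 -> iter s diff f = 0.
Proof. by move=> /subnK <- f0; rewrite iterD f0 iter_diff0. Qed.

(** By the twisted Leibniz rule [diffM], [diff (f * g)] is a sum of three products, each with a
    smaller value of [a + b], or zero when a difference already vanishes. *)
Lemma iter_diffM_eq0 a b f g : iter a.+1 diff f = 0 -> iter b.+1 diff g = 0 ->
  iter (a + b).+1 diff (f * g) = 0.
Proof.
have diffM f' g' : diff (f' * g') = diff f' * g' + f' * diff g' + diff f' * diff g'.
  by rewrite /diff rmorphM; ring.
have [m] := ubnP (a + b); elim: m => // m IH in a b f g *.
rewrite ltnS => le_m f0 g0; rewrite iterSr diffM !iter_diffD.
have -> : iter (a + b) diff (diff f * g) = 0.
  case: a => [|a] in le_m f0 *; first by rewrite /= in f0; rewrite f0 mul0r iter_diff0.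
  by apply: IH => //; rewrite -iterSr.
have -> : iter (a + b) diff (f * diff g) = 0.
  case: b => [|b] in le_m g0 *; first by rewrite /= in g0; rewrite g0 mulr0 iter_diff0.
  by rewrite addnS; apply: IH; rewrite -?iterSr // -addnS.
have -> : iter (a + b) diff (diff f * diff g) = 0.
  case: a => [|a] in le_m f0 *; first by rewrite /= in f0; rewrite f0 mul0r iter_diff0.
  case: b => [|b] in le_m g0 *; first by rewrite /= in g0; rewrite g0 mulr0 iter_diff0.
  apply: (iter_diff_eq0 (r := (a + b).+1)); first by lia.
  by apply: IH; rewrite -?iterSr //; lia.
by rewrite !addr0.
Qed.

Variables (A : R -> Prop) (ringA : subring A).
Hypothesis fixA : forall a, A a -> sigma a = a.

Lemma submodule_iter_diff r L : submodule A L -> submodule A (fun f => L (iter r diff f)).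
Proof.
move=> [L0 LD LZ]; split=> [|f g Lf Lg|a f Aa Lf].
- by rewrite iter_diff0.
- by rewrite iter_diffD; apply: LD.
- by rewrite iter_diffZ ?fixA //; apply: LZ.
Qed.

Variables (y h : R).
Hypotheses (sigma_y : sigma y = y + h) (Ah : A h).

(** This only says that some expression in [y] of degree below [d] exists: high powers of [y] may
    satisfy it too, as [lowdeg_x1] shows. *)
Definition lowdeg d := lspan A (mkseq (fun i => y ^+ i) d).

Lemma lowdeg_submodule d : submodule A (lowdeg d).
Proof. exact: submodule_lspan. Qed.

Lemma lowdegX d i : (i < d)%N -> lowdeg d (y ^+ i).
Proof.
by move=> lt_id; apply: mem_lspan => //; apply/mapP; exists i; rewrite ?mem_iota.
Qed.

Lemma sub_lowdeg d e f : (d <= e)%N -> lowdeg d f -> lowdeg e f.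
Proof.
move=> le_de; apply: (lspan_submodule (lowdeg_submodule e)) => s /mapP[i].
by rewrite mem_iota => /andP[_ lti] ->; apply: lowdegX; lia.
Qed.

(** In the binomial expansion of [(y + h) ^+ m], only terms of degree at most [m - 2] remain once
    the first two are removed. *)
Lemma diffX m : lowdeg m.-1 (diff (y ^+ m) - m%:R * h * y ^+ m.-1).
Proof.
have [L0 LD LZ] := lowdeg_submodule m.-1.
rewrite /diff rmorphXn sigma_y; case: m => [|m] in L0 LD LZ *.
  by rewrite (_ : _ - _ = 0) //; rewrite !expr0; ring.
(* Two terms are split off the sum, so [bump 0 (bump 0 i)] stands for [i + 2]. *)
rewrite exprDn big_ord_recl big_ord_recl /= bin0 bin1.
rewrite (_ : _ - _ - _ = \sum_(i < m) y ^+ (m.+1 - bump 0 (bump 0 i)) *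
    h ^+ bump 0 (bump 0 i) *+ 'C(m.+1, bump 0 (bump 0 i))).
  apply: (submodule_sum (lowdeg_submodule m)) => i _; rewrite -mulr_natl (mulrC (y ^+ _)) mulrA; apply: LZ.
    by apply: subringM => //; [exact: subring_nat | exact: subringX].
  by apply: lowdegX; rewrite /bump /=; have := ltn_ord i; lia.
rewrite /bump /= !add1n subn0 subSS subn0 expr0 expr1 mulr1n -mulr_natl; ring.
Qed.

Lemma diff_lowdeg d f : lowdeg d f -> lowdeg d.-1 (diff f).
Proof.
have subL := submodule_iter_diff 1 (lowdeg_submodule d.-1).
apply: (lspan_submodule subL) => s /mapP[i].
rewrite mem_iota => /andP[_ lti] -> /=; have [L0 LD LZ] := lowdeg_submodule d.-1.
case: i => [|i] in lti *; first by rewrite expr0 /diff rmorph1 subrr.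
rewrite -[diff _](subrK (i.+1%:R * h * y ^+ i)); apply: LD.
  by apply: sub_lowdeg (diffX i.+1); lia.
apply: LZ; first by apply: subringM => //; exact: subring_nat.
by apply: lowdegX; lia.
Qed.

(** Up to lower degree in [y], [diff] acts as [h] times the derivative, whence the falling
    factorial; the error stays low because [diff] lowers degree. *)
Lemma iter_diffX r a : (r <= a)%N ->
  lowdeg (a - r) (iter r diff (y ^+ a) - (a ^_ r)%:R * h ^+ r * y ^+ (a - r)).
Proof.
elim: r => [|r IH] lera.
  rewrite ffactn0 subn0 expr0 mul1r (_ : _ - _ = 0) /=; last by ring.
  by case: (lowdeg_submodule a).
have [L0 LD LZ] := lowdeg_submodule (a - r.+1).
have Ac : A ((a ^_ r)%:R * h ^+ r).
  by apply: subringM => //; [exact: subring_nat | exact: subringX].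
rewrite iterS; set c := _%:R * _ in IH Ac; set g := iter r diff _ in IH *.
rewrite (_ : _ - _ = diff (g - c * y ^+ (a - r)) +
  c * (diff (y ^+ (a - r)) - (a - r)%:R * h * y ^+ (a - r).-1)).
  apply: LD; first by rewrite subnS; apply: diff_lowdeg; apply: IH; exact: ltnW.
  by apply: LZ => //; rewrite subnS; exact: diffX.
by rewrite /diff rmorphB [sigma (c * _)]rmorphM (fixA Ac) /c ffactnSr natrM exprS subnS; ring.
Qed.

(** For [r = a] the error in [iter_diffX] lies in the span of the empty list, so it vanishes. *)
Lemma iter_diffX_full a : iter a diff (y ^+ a) = (a`!)%:R * h ^+ a.
Proof.
have [c [_]] := iter_diffX (leqnn a); rewrite subnn size_mkseq big_ord0.
by move/eqP; rewrite subr_eq0 ffactnn expr0 mulr1 => /eqP.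
Qed.

Lemma iter_diffX_eq0 r a : (a < r)%N -> iter r diff (y ^+ a) = 0.
Proof.
move=> lt_ar; apply: (iter_diff_eq0 lt_ar); rewrite iterS iter_diffX_full /diff fixA ?subrr //.
by apply: subringM => //; [exact: subring_nat | exact: subringX].
Qed.

Variable p : nat.
Hypotheses (charR : p \in [pchar R]) (h_neq0 : h != 0).

Lemma fact_neq0 a : (a < p)%N -> (a`!)%:R != 0 :> R.
Proof.
elim: a => [|a IH] lt_ap; first by rewrite oner_eq0.
by rewrite factS natrM mulf_neq0 ?IH 1?ltnW // -(dvdn_pcharf charR) gtnNdvd.
Qed.

(* Applying [diff^(d-1)] isolates the top coefficient. *)
Lemma coef_ker_diff n d (c : nat -> R) : (d <= p)%N -> (forall i, sigma (c i) = c i) ->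
  iter n diff (\sum_(i < d) c i * y ^+ i) = 0 ->
  forall i, (n <= i < d)%N -> c i = 0.
Proof.
move=> + fix_c; elim: d => [|d IH] le_dp; first by lia.
case: (leqP n d) => [le_nd|lt_dn] ker_n i lt_i; last by lia.
have cd0 : c d = 0.
  have := iter_diff_eq0 le_nd ker_n; rewrite big_ord_recr /= iter_diffD iter_diff_sum.
  rewrite big1 ?add0r => [|j _]; last by rewrite iter_diffZ // iter_diffX_eq0 ?mulr0.
  rewrite iter_diffZ // iter_diffX_full => /eqP; rewrite !mulf_eq0 expf_eq0 (negbTE h_neq0).
  by rewrite (negbTE (fact_neq0 le_dp)) andbF !orbF => /eqP.
have [->//|ne_id] := eqVneq i d.
apply: IH; [exact: ltnW | | by lia].
by move: ker_n; rewrite big_ord_recr /= cd0 mul0r addr0.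
Qed.

End DifferenceOperator.

(** * Monomials in two elements that satisfy trinomial equations of degree [p] *)

Section BinaryMonomials.

Variables (R : idomainType) (A : R -> Prop) (ringA : subring A).
Variables (p : nat) (p_gt1 : (1 < p)%N) (y z : R).

(** The monomials [y ^+ i * z ^+ j] with [i < d], [j < p] are numbered by [t = i * p + j]: the size
    is immediate, and a sum over the list becomes a double sum. *)
Definition monos (d : nat) : seq R := mkseq (fun t => y ^+ (t %/ p) * z ^+ (t %% p)) (d * p).

Lemma mem_monos d i j : (i < d)%N -> (j < p)%N -> y ^+ i * z ^+ j \in monos d.
Proof.
move=> lt_id lt_jp; apply/mapP; exists (i * p + j)%N; first by rewrite mem_iota; nia.
by rewrite divnMDl ?modnMDl ?divn_small ?modn_small ?addn0 //; lia.
Qed.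

Lemma monosP d s : s \in monos d ->
  exists i j, [/\ (i < d)%N, (j < p)%N & s = y ^+ i * z ^+ j].
Proof.
case/mapP=> t; rewrite mem_iota => /andP[_ lt_t] ->; exists (t %/ p)%N, (t %% p)%N.
by split=> //; rewrite ?ltn_divLR ?ltn_mod; lia.
Qed.

Lemma sum_monos d (c : nat -> R) :
  \sum_(t < size (monos d)) c t * (monos d)`_t =
  \sum_(i < d) (\sum_(j < p) c (i * p + j)%N * z ^+ j) * y ^+ i.
Proof.
rewrite size_mkseq -(big_mkord xpredT (fun t => c t * (monos d)`_t)) big_nat_mul.
rewrite big_mkord; apply: eq_bigr => i _; rewrite big_distrl /=.
rewrite -[X in \sum_(X <= _ < _) _]add0n big_addn mulSn addnK big_mkord.
apply: eq_bigr => j _; rewrite addnC nth_mkseq; last by have := ltn_ord i; have := ltn_ord j; nia.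
rewrite divnMDl ?modnMDl ?divn_small ?modn_small ?addn0 //; last by lia.
by rewrite -mulrA [_ ^+ j * _]mulrC.
Qed.

Lemma lspan_monosP d f : lspan A (monos d) f ->
  exists a : nat -> nat -> R, (forall i j, A (a i j)) /\
    f = \sum_(i < d) (\sum_(j < p) a i j * z ^+ j) * y ^+ i.
Proof.
by case=> c [Ac ->]; exists (fun i j => c (i * p + j)%N); rewrite sum_monos.
Qed.

Section Trinomial.
Variables (alpha beta gamma delta : R).
Hypotheses (Aalpha : A alpha) (Abeta : A beta) (Agamma : A gamma) (Adelta : A delta).
Hypotheses (y_p : y ^+ p = alpha * y + beta) (z_p : z ^+ p = gamma * z + delta).

(** Rewriting a [p]-th power by its trinomial relation strictly lowers [i + j], since [p > 1]. *)
Lemma lspan_monosX i j : lspan A (monos p) (y ^+ i * z ^+ j).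
Proof.
have [L0 LD LZ] := submodule_lspan ringA (monos p).
have [m] := ubnP (i + j); elim: m => // m IH in i j *; rewrite ltnS => le_m.
have [lt_ip|le_pi] := ltnP i p; last first.
  rewrite -(subnK le_pi) exprD y_p.
  rewrite (_ : _ * _ = alpha * (y ^+ (i - p).+1 * z ^+ j) + beta * (y ^+ (i - p) * z ^+ j)).
    by apply: LD; apply: LZ => //; apply: IH; lia.
  by rewrite exprS; ring.
have [lt_jp|le_pj] := ltnP j p; last first.
  rewrite -(subnK le_pj) exprD z_p.
  rewrite (_ : _ * _ = gamma * (y ^+ i * z ^+ (j - p).+1) + delta * (y ^+ i * z ^+ (j - p))).
    by apply: LD; apply: LZ => //; apply: IH; lia.
  by rewrite exprS; ring.
by apply: mem_lspan => //; apply: mem_monos.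
Qed.

Lemma lspan_monosM f g :
  lspan A (monos p) f -> lspan A (monos p) g -> lspan A (monos p) (f * g).
Proof.
have [L0 LD LZ] := submodule_lspan ringA (monos p).
move=> Lf Lg; apply: (lspan_submodule (A := A) (L := fun f => lspan A (monos p) (f * g)) _ _ Lf).
  split=> [|f1 f2 L1 L2|a f1 Aa L1]; first by rewrite mul0r.
    by rewrite mulrDl; apply: LD.
  by rewrite -mulrA; apply: LZ.
move=> s /monosP[i [j [_ _ ->]]].
apply: (lspan_submodule (A := A)
  (L := fun g => lspan A (monos p) (y ^+ i * z ^+ j * g)) _ _ Lg).
  split=> [|f1 f2 L1 L2|a f1 Aa L1]; first by rewrite mulr0.
    by rewrite mulrDr; apply: LD.
  by rewrite mulrCA; apply: LZ.
move=> t /monosP[i' [j' [_ _ ->]]].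
by rewrite mulrACA -!exprD; apply: lspan_monosX.
Qed.

Lemma lspan_monosC a : A a -> lspan A (monos p) a.
Proof.
move=> Aa; rewrite -[a]mulr1; apply: (submoduleZ (submodule_lspan ringA _)) => //.
by have := lspan_monosX 0 0; rewrite !expr0 mulr1.
Qed.

End Trinomial.

(** As [s1] translates [y] and fixes [z], it separates the powers of [y], whose coefficients are
    polynomials in [z]; then [s2] separates the powers of [z]. In both uses of [coef_ker_diff],
    [n = 0]: the sum itself is zero. *)
Lemma indep_monos (s1 s2 : {rmorphism R -> R}) (h1 h2 : R) d :
  p \in [pchar R] -> (d <= p)%N ->
  (forall a, A a -> s1 a = a) -> (forall a, A a -> s2 a = a) ->
  A h1 -> A h2 -> h1 != 0 -> h2 != 0 ->
  s1 y = y + h1 -> s1 z = z -> s2 z = z + h2 ->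
  indep A (monos d).
Proof.
move=> charR le_dp fix1 fix2 A1 A2 h1_neq0 h2_neq0 s1y s1z s2z c Ac.
rewrite sum_monos size_mkseq => c0 t lt_t.
have lt_d : (t %/ p < d)%N by rewrite ltn_divLR; lia.
pose g i := \sum_(j < p) c (i * p + j)%N * z ^+ j.
have g0 : g (t %/ p)%N = 0.
  apply: (coef_ker_diff ringA fix1 s1y A1 charR h1_neq0 (n := 0) (d := d) (c := g)) => //.
  move=> i; rewrite /g rmorph_sum; apply: eq_bigr => j _.
  by rewrite rmorphM rmorphXn s1z fix1.
rewrite (divn_eq t p).
apply: (coef_ker_diff ringA fix2 s2z A2 charR h2_neq0 (n := 0) (d := p)
  (c := fun j => c (t %/ p * p + j)%N)) => //; first by move=> i; apply: fix2.
by rewrite /= ltn_mod; lia.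
Qed.

End BinaryMonomials.

(** * The polynomial ring, the subring [A], and the substitutions acting on them *)

Section Polynomials.

Variable k : fieldType.
Local Notation P := {mpoly k[4]}.
Local Notation x1 := (@x1 k). Local Notation x2 := (@x2 k).
Local Notation x3 := (@x3 k). Local Notation x4 := (@x4 k).
Local Notation u := (@u k).

Section Substitution.
Variables a b c d : P.
Lemma subst_x1 : comp_mpoly [tuple a; b; c; d] x1 = a. Proof. exact: comp_mpolyXU. Qed.
Lemma subst_x2 : comp_mpoly [tuple a; b; c; d] x2 = b. Proof. exact: comp_mpolyXU. Qed.
Lemma subst_x3 : comp_mpoly [tuple a; b; c; d] x3 = c. Proof. exact: comp_mpolyXU. Qed.
Lemma subst_x4 : comp_mpoly [tuple a; b; c; d] x4 = d. Proof. exact: comp_mpolyXU. Qed.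
Definition substE := (subst_x1, subst_x2, subst_x3, subst_x4).
End Substitution.

Lemma mpoly4_ind (L : P -> Prop) :
  (forall a : k, L a%:MP) -> (forall f g, L f -> L g -> L (f + g)) ->
  (forall f g, L f -> L g -> L (f * g)) -> L x1 -> L x2 -> L x3 -> L x4 ->
  forall f, L f.
Proof.
move=> LC LD LM L1 L2 L3 L4 f.
have L_X (i : 'I_4) : L 'X_i.
  by case: i => [[|[|[|[|]]]] lt_i].
have LXn g e : L g -> L (g ^+ e).
  move=> Lg; elim: e => [|e IH]; first by rewrite expr0 -mpolyC1.
  by rewrite exprS; apply: LM.
rewrite [f]mpolyE; elim/big_ind: _ => [|//|m _]; first by rewrite -mpolyC0.
rewrite -mul_mpolyC; apply: (LM _ _) => //; rewrite mpolyXE_id.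
by elim/big_ind: _ => [|//|i _]; [rewrite -mpolyC1 | apply: LXn].
Qed.

Lemma x3_neq0 : x3 != 0. Proof. by rewrite -msupp_eq0 msuppX. Qed.
Lemma x4_neq0 : x4 != 0. Proof. by rewrite -msupp_eq0 msuppX. Qed.

(* The substitution [x3 := 0] detects divisibility by [x3]. *)
Lemma x3_dvd d e a b : x4 ^+ d * a = x3 ^+ e * b -> exists c, a = x3 ^+ e * c.
Proof.
elim: e => [|e IH] in a b *; first by exists a; rewrite expr0 mul1r.
pose pi := comp_mpoly [tuple x1; x2; 0; x4] : P -> P.
have div_pi f : exists g, f - pi f = x3 * g.
  elim/mpoly4_ind: f => [c|f g [f' Ef] [g' Eg]|f g [f' Ef] [g' Eg]||||].
  - by exists 0; rewrite /pi comp_mpolyC subrr mulr0.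
  - exists (f' + g'); rewrite /pi rmorphD /= -/(pi _) mulrDr -Ef -Eg; ring.
  - exists (f' * g + pi f * g'); rewrite /pi rmorphM /= -!/(pi _).
    by rewrite mulrDr mulrA -Ef mulrCA -Eg; ring.
  - by exists 0; rewrite /pi substE; ring.
  - by exists 0; rewrite /pi substE; ring.
  - by exists 1; rewrite /pi substE; ring.
  - by exists 0; rewrite /pi substE; ring.
(* [pi] kills the right-hand side, which contains [x3], and fixes the nonzero [x4]. *)
move=> ab; have pia : pi a = 0.
  have := congr1 pi ab; rewrite /pi !rmorphM /= !rmorphXn /= !substE exprS !mul0r => /eqP.
  by rewrite mulf_eq0 expf_eq0 (negbTE x4_neq0) andbF => /eqP.
have [a' ] := div_pi a; rewrite pia subr0 => Ea; rewrite {}Ea in ab *.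
have [|c ->] := IH a' b; last by exists c; rewrite exprS mulrA.
by apply: (mulfI x3_neq0); rewrite mulrCA ab exprS mulrA.
Qed.

Variable p : nat.
Hypotheses (p_pr : prime p) (char_p : p \in [pchar k]).
Local Notation A := (in_A p).
Local Notation N1 := (x1 ^+ p - x1 * x3 ^+ p.-1).
Local Notation N2 := (x2 ^+ p - x2 * x4 ^+ p.-1).

Lemma char_mpoly : p \in [pchar P].
Proof.
rewrite inE p_pr /=; have := pcharf0 char_p => p0.
by rewrite -mpolyC_nat p0 mpolyC0.
Qed.

Lemma subring_in_A : subring (A : P -> Prop).
Proof.
split=> [|a b [q ->] [q' ->]|a b [q ->] [q' ->]].
- by exists 1; rewrite rmorph1.
- by exists (q - q'); rewrite rmorphB.
- by exists (q * q'); rewrite rmorphM.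
Qed.

Lemma in_A_N1 : A N1. Proof. by exists x1; rewrite subst_x1. Qed.
Lemma in_A_N2 : A N2. Proof. by exists x2; rewrite subst_x2. Qed.
Lemma in_A_x3 : A x3. Proof. by exists x3; rewrite subst_x3. Qed.
Lemma in_A_x4 : A x4. Proof. by exists x4; rewrite subst_x4. Qed.
Lemma in_AC (c : k) : A c%:MP. Proof. by exists c%:MP; rewrite comp_mpolyC. Qed.

Lemma in_A_ind (L : P -> Prop) :
  (forall c : k, L c%:MP) -> (forall f g, L f -> L g -> L (f + g)) ->
  (forall f g, L f -> L g -> L (f * g)) -> L N1 -> L N2 -> L x3 -> L x4 ->
  forall a, A a -> L a.
Proof.
move=> LC LD LM L1 L2 L3 L4 _ [q ->].
elim/mpoly4_ind: q => [c|f g|f g||||]; rewrite ?substE ?comp_mpolyC //.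
- by rewrite rmorphD; apply: LD.
- by rewrite rmorphM; apply: LM.
Qed.

(** Frobenius is additive, and the extra [g ^+ p] cancels against [g * g ^+ p.-1]. This is the
    invariance of [N1] and [N2]. *)
Lemma Frobenius_translate (f g : P) : (f + g) ^+ p - (f + g) * g ^+ p.-1 = f ^+ p - f * g ^+ p.-1.
Proof.
rewrite exprDn_pchar ?(pnatE _ p_pr) ?char_mpoly // mulrDl -exprS prednK ?prime_gt0 //; ring.
Qed.

(** The substitution of [sigma_act] packaged as a ring morphism, so that [iter r (diff sigma)] is
    convertible to [Delta_pow r]. *)
Definition sigma : {rmorphism P -> P} := comp_mpoly [tuple x1 + x3; x2 + x4; x3; x4].
(** [sigma1] and [sigma2] fix [A] like [sigma], but move one variable each; they are the morphisms
    that [indep_monos] asks for. *)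
Definition sigma1 : {rmorphism P -> P} := comp_mpoly [tuple x1 + x3; x2; x3; x4].
Definition sigma2 : {rmorphism P -> P} := comp_mpoly [tuple x1; x2 + x4; x3; x4].
Definition swap : {rmorphism P -> P} := comp_mpoly [tuple x2; x1; x4; x3].

Lemma fix_A (a b f : P) : a ^+ p - a * x3 ^+ p.-1 = N1 -> b ^+ p - b * x4 ^+ p.-1 = N2 ->
  A f -> comp_mpoly [tuple a; b; x3; x4] f = f.
Proof.
move=> Ea Eb; elim/in_A_ind: f / => [c|f g|f g||||]; rewrite ?comp_mpolyC ?substE //.
- by rewrite rmorphD /= => -> ->.
- by rewrite rmorphM /= => -> ->.
- by rewrite rmorphB rmorphM !rmorphXn /= !substE.
- by rewrite rmorphB rmorphM !rmorphXn /= !substE.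
Qed.

Lemma sigma_A f : A f -> sigma f = f.
Proof. by apply: fix_A; rewrite Frobenius_translate. Qed.
Lemma sigma1_A f : A f -> sigma1 f = f.
Proof. by apply: fix_A; rewrite ?Frobenius_translate. Qed.
Lemma sigma2_A f : A f -> sigma2 f = f.
Proof. by apply: fix_A; rewrite ?Frobenius_translate. Qed.

Lemma swap_A f : A f -> A (swap f).
Proof.
have [_ _ AM] := subring_in_A.
elim/in_A_ind: f / => [c|f g Af Ag|f g Af Ag||||]; rewrite /= ?comp_mpolyC ?substE //.
- exact: in_AC.
- by rewrite rmorphD; apply: (subringD subring_in_A).
- by rewrite rmorphM; apply: AM.
- by rewrite rmorphB rmorphM !rmorphXn /= !substE; exact: in_A_N2.
- by rewrite rmorphB rmorphM !rmorphXn /= !substE; exact: in_A_N1.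
- exact: in_A_x4.
- exact: in_A_x3.
Qed.

Lemma swapK f : swap (swap f) = f.
Proof.
elim/mpoly4_ind: f => [c|f g Ef Eg|f g Ef Eg||||]; rewrite /= ?comp_mpolyC ?substE //.
- by rewrite !rmorphD /= Ef Eg.
- by rewrite !rmorphM /= Ef Eg.
Qed.

Lemma swap_sigma f : swap (sigma f) = sigma (swap f).
Proof.
elim/mpoly4_ind: f => [c|f g Ef Eg|f g Ef Eg||||]; rewrite /= ?comp_mpolyC ?substE //.
- by rewrite !rmorphD /= Ef Eg.
- by rewrite !rmorphM /= Ef Eg.
- by rewrite rmorphD /= !substE.
- by rewrite rmorphD /= !substE.
Qed.

Lemma swap_Delta_pow r f : swap (Delta_pow r f) = Delta_pow r (swap f).
Proof. by elim: r => //= r IH; rewrite /Delta rmorphB /= -IH; congr (_ - _); exact: swap_sigma. Qed.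

End Polynomials.

(** * Relations over [A], two monomial families, and the kernel after inverting [x3] *)

Section KernelBasis.

Variable k : fieldType.
Local Notation P := {mpoly k[4]}.
Local Notation x1 := (@x1 k). Local Notation x2 := (@x2 k).
Local Notation x3 := (@x3 k). Local Notation x4 := (@x4 k).
Local Notation u := (@u k).
Local Notation sigma := (@sigma k). Local Notation sigma1 := (@sigma1 k).
Local Notation sigma2 := (@sigma2 k). Local Notation swap := (@swap k).
Variable p : nat.
Hypotheses (p_pr : prime p) (char_p : p \in [pchar k]).
Local Notation A := (in_A p).
Local Notation N1 := (x1 ^+ p - x1 * x3 ^+ p.-1).
Local Notation N2 := (x2 ^+ p - x2 * x4 ^+ p.-1).
Let ringA := @subring_in_A k p.
Let char_P := char_mpoly p_pr char_p.
Let p_gt1 : (1 < p)%N := prime_gt1 p_pr.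

Lemma sigma_x1 : sigma x1 = x1 + x3. Proof. exact: subst_x1. Qed.
Lemma sigma_u : sigma u = u.
Proof. by rewrite /u rmorphB !rmorphM /= !substE; ring. Qed.
Lemma sigma2_u : sigma2 u = u + - (x3 * x4).
Proof. by rewrite /u rmorphB !rmorphM /= !substE; ring. Qed.
Lemma swap_u : swap u = - u.
Proof. by rewrite /u rmorphB !rmorphM /= !substE; ring. Qed.

Lemma x1_p : x1 ^+ p = x3 ^+ p.-1 * x1 + N1. Proof. by ring. Qed.
Lemma x2_p : x2 ^+ p = x4 ^+ p.-1 * x2 + N2. Proof. by ring. Qed.
(** Frobenius reduces this to [x1_p] and [x2_p]. The relation has the trinomial shape, so [x1] and
    [u] can be treated like [x1] and [x2]. *)
Lemma u_p : u ^+ p = (x3 * x4) ^+ p.-1 * u + (x4 ^+ p * N1 - x3 ^+ p * N2).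
Proof.
have -> : u ^+ p = (x1 * x4) ^+ p - (x2 * x3) ^+ p.
  apply/eqP; rewrite eq_sym subr_eq -exprDn_pchar ?(pnatE _ p_pr) ?char_P //.
  by rewrite /u subrK.
rewrite /u !exprMn; case: (p) (prime_gt0 p_pr) => // q _; rewrite !exprS /=; ring.
Qed.

Lemma in_A_x3X e : A (x3 ^+ e). Proof. apply: (subringX ringA); exact: in_A_x3. Qed.
Lemma in_A_x4X e : A (x4 ^+ e). Proof. apply: (subringX ringA); exact: in_A_x4. Qed.
Lemma in_A_sign e : A ((-1) ^+ e : P).
Proof. by apply: (subringX ringA); apply: (subringN ringA); exact: (subring1 ringA). Qed.
Lemma in_A_u_coef : A ((x3 * x4) ^+ p.-1).
Proof. by rewrite exprMn; apply: subringM; [|exact: in_A_x3X | exact: in_A_x4X]. Qed.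
Lemma in_A_u_const : A (x4 ^+ p * N1 - x3 ^+ p * N2).
Proof.
apply: subringB => //; apply: subringM => //.
- exact: in_A_x4X.
- exact: in_A_N1.
- exact: in_A_x3X.
- exact: in_A_N2.
Qed.

Lemma indep_monos_x1x2 : indep A (monos p x1 x2 p).
Proof.
apply: (indep_monos ringA p_gt1 char_P (leqnn p) (sigma1_A p_pr char_p) (sigma2_A p_pr char_p)
  (in_A_x3 _ _) (in_A_x4 _ _) (x3_neq0 _) (x4_neq0 _)); exact: comp_mpolyXU.
Qed.

(** [sigma] moves [x1] and fixes [u], while [sigma2] translates [u] by the nonzero element
    [- (x3 * x4)] of [A]. *)
Lemma indep_monos_x1u n : (n <= p)%N -> indep A (monos p x1 u n).
Proof.
move=> le_np.
apply: (indep_monos ringA p_gt1 char_P le_np (sigma_A p_pr char_p) (sigma2_A p_pr char_p)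
  (in_A_x3 _ _) _ (x3_neq0 _) _ sigma_x1 sigma_u sigma2_u).
  by apply: subringN => //; apply: subringM; [|exact: in_A_x3 | exact: in_A_x4].
by rewrite oppr_eq0 mulf_neq0 ?x3_neq0 ?x4_neq0.
Qed.

Lemma lspan_x1x2 f : lspan A (monos p x1 x2 p) f.
Proof.
have LX := lspan_monosX ringA p_gt1 (in_A_x3X _) (in_A_N1 _ _) (in_A_x4X _) (in_A_N2 _ _) x1_p x2_p.
have LC := lspan_monosC ringA p_gt1 (in_A_x3X _) (in_A_N1 _ _) (in_A_x4X _) (in_A_N2 _ _) x1_p x2_p.
have LM := lspan_monosM ringA p_gt1 (in_A_x3X _) (in_A_N1 _ _) (in_A_x4X _) (in_A_N2 _ _) x1_p x2_p.
elim/mpoly4_ind: f => [c|f g|//||||].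
- exact/LC/in_AC.
- exact: (submoduleD (submodule_lspan ringA _)).
- by have := LX 1%N 0%N; rewrite mulr1.
- by have := LX 0%N 1%N; rewrite mul1r.
- exact/LC/in_A_x3.
- exact/LC/in_A_x4.
Qed.

(* After inverting [x3] one has [x2 = (x1 x4 - u) / x3]. *)
Lemma locally_x1u f : locally x3 (lspan A (monos p x1 u p)) f.
Proof.
have LX := lspan_monosX ringA p_gt1 (in_A_x3X _) (in_A_N1 _ _) in_A_u_coef in_A_u_const x1_p u_p.
have LC := lspan_monosC ringA p_gt1 (in_A_x3X _) (in_A_N1 _ _) in_A_u_coef in_A_u_const x1_p u_p.
have LM := lspan_monosM ringA p_gt1 (in_A_x3X _) (in_A_N1 _ _) in_A_u_coef in_A_u_const x1_p u_p.
have subL := submodule_lspan ringA (monos p x1 u p).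
have L_x1 : lspan A (monos p x1 u p) x1 by have := LX 1%N 0%N; rewrite mulr1.
have L_u : lspan A (monos p x1 u p) u by have := LX 0%N 1%N; rewrite mul1r.
elim/mpoly4_ind: f => [c|f g|f g [d Lf] [e Lg]||||].
- exact/locally_intro/LC/in_AC.
- exact: (submoduleD (submodule_locally ringA (in_A_x3 _ _) subL)).
- by exists (d + e)%N; rewrite exprD mulrACA; apply: LM.
- exact: locally_intro.
- exists 1%N; rewrite (_ : _ * _ = x4 * x1 - u); last by rewrite /u expr1; ring.
  by apply: (submoduleB ringA subL) => //; apply: (submoduleZ subL) => //; exact: in_A_x4.
- exact/locally_intro/LC/in_A_x3.
- exact/locally_intro/LC/in_A_x4.
Qed.

(** Collected by powers of [x1], a multiple [x3 ^+ e * f] has coefficients in [A[u]], which are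
    invariant; [coef_ker_diff] kills those of index at least [n]. *)
Lemma in_Kn_locally n f : (n <= p)%N -> in_Kn n f -> locally x3 (lspan A (monos p x1 u n)) f.
Proof.
move=> le_np Kf; have [e /lspan_monosP-/(_ p_gt1)[a [Aa Ef]]] := locally_x1u f.
pose c i := \sum_(j < p) a i j * u ^+ j.
have fix_c i : sigma (c i) = c i.
  rewrite rmorph_sum; apply: eq_bigr => j _.
  by rewrite rmorphM rmorphXn sigma_u (sigma_A p_pr char_p).
have c0 i : (n <= i < p)%N -> c i = 0.
  apply: (coef_ker_diff ringA (sigma_A p_pr char_p) sigma_x1 (in_A_x3 _ _) char_P
    (x3_neq0 _) (leqnn p) fix_c); rewrite -Ef iter_diffZ; first by rewrite [iter _ _ _]Kf mulr0.
  exact/(sigma_A p_pr char_p)/in_A_x3X.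
exists e; rewrite Ef -/(c _) (bigID (fun i : 'I_p => (i < n)%N)) /= [X in _ + X]big1.
  have subL := submodule_lspan ringA (monos p x1 u n).
  rewrite addr0; apply: (submodule_sum subL) => i lt_in; rewrite big_distrl /=.
  apply: (submodule_sum subL) => j _; rewrite -mulrA; apply: (submoduleZ subL) => //.
  by apply: mem_lspan => //; rewrite mulrC; apply: mem_monos.
by move=> i; rewrite -leqNgt => le_ni; rewrite -/(c i) c0 ?mul0r // le_ni /=.
Qed.

(** A multiple of [f] by a power of [x3] is a combination of [x1 ^+ i * u ^+ j] with [i < p], and
    [p] differences kill each of these. *)
Lemma Delta_pow_p (f : P) : Delta_pow p f = 0.
Proof.
have [e Lf] := locally_x1u f.
have fixA := sigma_A p_pr char_p.
have x3_inj : injective ( *%R (x3 ^+ e)) by apply/mulfI/expf_neq0/x3_neq0.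
apply: x3_inj; rewrite mulr0 -[Delta_pow p f]/(iter p (diff sigma) f).
rewrite -iter_diffZ; last exact/fixA/in_A_x3X.
have sub0 : submodule A (fun f => f = 0 :> P).
  by split=> [//|_ _ -> ->|a _ _ ->]; rewrite ?addr0 ?mulr0.
apply: (lspan_submodule (submodule_iter_diff fixA p sub0) _ Lf).
move=> _ /(monosP p_gt1)[i [j [lt_ip _ ->]]] /=.
rewrite mulrC iter_diffZ ?rmorphXn ?sigma_u //.
by rewrite (iter_diffX_eq0 ringA fixA sigma_x1 (in_A_x3 _ _) lt_ip) mulr0.
Qed.

(** The monomial [1], of index [0], belongs to a basis of the whole ring over [A]. Comparing the
    coefficients of [1] in two expansions of [x3 ^+ e * c] gives [c = a 0]. *)
Lemma in_A_div e c : A (x3 ^+ e * c) -> A c.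
Proof.
move=> Ac; have [a [Aa Ec]] := lspan_x1x2 c.
pose b t := x3 ^+ e * a t - (t == 0%N)%:R * (x3 ^+ e * c).
have Ab t : A (b t).
  apply: subringB => //; apply: subringM => //; last exact: subring_nat.
  exact: in_A_x3X.
have size_gt0 : (0 < size (monos p x1 x2 p))%N by rewrite size_mkseq muln_gt0 prime_gt0.
have b0 : \sum_(t < size (monos p x1 x2 p)) b t * (monos p x1 x2 p)`_t = 0.
  rewrite /b; under eq_bigr do rewrite mulrBl -mulrA.
  rewrite sumrB -big_distrr /= -Ec (bigD1 (Ordinal size_gt0)) //= big1 => [|t]; last first.
    by rewrite -(inj_eq val_inj) /= => /negbTE->; rewrite !mul0r.
  rewrite nth_mkseq ?muln_gt0 ?prime_gt0 // div0n mod0n !expr0.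
  by rewrite !(mul1r, mulr1) addr0 subrr.
have := indep_monos_x1x2 Ab b0 size_gt0; rewrite /b mul1r => /eqP.
by rewrite subr_eq0 => /eqP/(mulfI (expf_neq0 _ (x3_neq0 _))) <-.
Qed.

(** * The family [S]: its members, its size, and its inclusion in the kernel *)

Lemma MkP kk s : reflect (exists i j, [/\ (i + j = kk)%N, (i < p)%N, (j < p)%N &
  s = x1 ^+ i * x2 ^+ j]) (s \in Mk k p kk).
Proof.
apply: (iffP mapP) => [[i]|[i [j [<- lt_ip lt_jp ->]]]].
  rewrite mem_filter mem_iota => /andP[/andP[lt_ip lt_jp] lt_i] ->.
  by exists i, (kk - i)%N; split=> //; lia.
by exists i; rewrite ?addKn // mem_filter mem_iota; lia.
Qed.

Lemma count_interval a b m : (a <= b <= m)%N ->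
  count (fun i => a <= i < b)%N (iota 0 m) = (b - a)%N.
Proof.
move=> le_abm; rewrite (_ : m = a + ((b - a) + (m - b)))%N; last by lia.
rewrite !iotaD !count_cat add0n.
rewrite (@eq_in_count _ _ pred0 (iota 0 a)) => [|i]; last by rewrite mem_iota /=; lia.
rewrite (@eq_in_count _ _ predT (iota a _)) => [|i]; last by rewrite mem_iota /=; lia.
rewrite (@eq_in_count _ _ pred0 (iota (a + _) _)) => [|i]; last by rewrite mem_iota /=; lia.
by rewrite !count_pred0 count_predT size_iota addn0.
Qed.

Lemma size_Mk kk : (kk <= 2 * p - 2)%N ->
  size (Mk k p kk) = (if kk < p then kk.+1 else 2 * p - 1 - kk)%N.
Proof.
move=> le_kk; rewrite size_map size_filter.
(* The condition [kk - i < p] is the lower bound on [i], which truncates to [0] when [kk < p]. *)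
rewrite (@eq_in_count _ _ (fun i => kk.+1 - p <= i < minn p kk.+1)%N) => [|i].
  by rewrite count_interval; [case: ltnP|]; lia.
by rewrite mem_iota; lia.
Qed.

Variables (n : nat) (n_le : (1 <= n <= p)%N).
Let le_np : (n <= p)%N. Proof. by case/andP: n_le. Qed.
Local Notation S0 := (M_part k p n ++ U_part k p n ++ D_part k p n).

Lemma mem_M i j : (i + j < n)%N -> x1 ^+ i * x2 ^+ j \in M_part k p n.
Proof.
move=> lt_n; apply/flatten_mapP; exists (i + j)%N; first by rewrite mem_iota.
by apply/MkP; exists i, j; split=> //; lia.
Qed.

Lemma mem_U kk i j : (1 <= kk <= p - n)%N -> (i + j = n.-1)%N ->
  u ^+ kk * (x1 ^+ i * x2 ^+ j) \in U_part k p n.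
Proof.
move=> le_kk ij; apply/flatten_mapP; exists kk; first by rewrite mem_iota; lia.
by apply: map_f; apply/MkP; exists i, j; split=> //; lia.
Qed.

Lemma mem_D i j : (i < p)%N -> (j < p)%N -> (2 * p - n <= i + j)%N ->
  Delta_pow (p - n) (x1 ^+ i * x2 ^+ j) \in D_part k p n.
Proof.
move=> lt_ip lt_jp le_ij; apply/flatten_mapP; exists (i + j)%N; first by rewrite mem_iota; lia.
by apply: map_f; apply/MkP; exists i, j; split.
Qed.

Lemma S_ind (L : P -> Prop) :
  (forall i j, (i + j < n)%N -> L (x1 ^+ i * x2 ^+ j)) ->
  (forall kk i j, (1 <= kk <= p - n)%N -> (i + j = n.-1)%N ->
    L (u ^+ kk * (x1 ^+ i * x2 ^+ j))) ->
  (forall i j, (i < p)%N -> (j < p)%N -> (2 * p - n <= i + j)%N ->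
    L (Delta_pow (p - n) (x1 ^+ i * x2 ^+ j))) ->
  {in S0, forall s, L s}.
Proof.
move=> LM LU LD s; rewrite !mem_cat => /or3P[] /flatten_mapP[kk]; rewrite mem_iota => le_kk.
- by case/MkP=> i [j [ij _ _ ->]]; apply: LM; lia.
- by case/mapP=> _ /MkP[i [j [ij _ _ ->]]] ->; apply: LU; lia.
- by case/mapP=> _ /MkP[i [j [ij lt_ip lt_jp ->]]] ->; apply: LD; lia.
Qed.

(** The parts contribute [1 + ... + n], [(p - n) * n] and [1 + ... + (n - 1)]; the two triangular
    numbers add up to [n * n]. *)
Lemma size_S : size S0 = (n * p)%N.
Proof.
have triang m : (2 * \sum_(0 <= i < m) i.+1 = m * m.+1)%N.
  by elim: m => [|m IH]; [rewrite big_geq | rewrite big_nat_recr //= mulnDr IH; lia].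
have triang' m : (\sum_(0 <= i < m) (m - i) = \sum_(0 <= i < m) i.+1)%N.
  by rewrite big_nat_rev /= !big_nat; apply: eq_bigr => i; lia.
have sM : size (M_part k p n) = (\sum_(0 <= i < n) i.+1)%N.
  rewrite size_flatten /shape -map_comp sumnE big_map -{1}[n]subn0 -/(index_iota 0 n).
  by rewrite !big_nat; apply: eq_bigr => i lt_i; rewrite /= size_Mk; [case: ltnP|]; lia.
have sU : size (U_part k p n) = ((p - n) * n)%N.
  rewrite size_flatten /shape -map_comp sumnE big_map.
  have sn : size (Mk k p n.-1) = n by rewrite size_Mk; [case: ltnP|]; lia.
  under eq_bigr do rewrite /= size_map sn.
  by rewrite big_const_seq count_predT size_iota iter_addn_0 mulnC.
have sD : size (D_part k p n) = (\sum_(0 <= i < n.-1) i.+1)%N.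
  rewrite size_flatten /shape -map_comp sumnE big_map -triang' -[(2 * p - n)%N]addn0 iotaDl.
  rewrite big_map subn1 -{1}[n.-1]subn0 -/(index_iota 0 n.-1).
  by rewrite !big_nat; apply: eq_bigr => i lt_i; rewrite /= size_map size_Mk; [case: ltnP|]; lia.
rewrite !size_cat sM sU sD; have := triang n; have := triang n.-1.
move: (bigop.body _ _ _) (bigop.body _ _ _) => a b; nia.
Qed.

(** For [M], nilpotency orders add; for [U], the factor [u] is invariant; for [D], the two iterates
    of the difference compose to the [p]-th, which is zero. *)
Lemma in_Kn_S s : s \in S0 -> in_Kn n s.
Proof.
have fixA := sigma_A p_pr char_p.
have sigma_x2 : sigma x2 = x2 + x4 by exact: subst_x2.
have K_mono i j : (i + j < n)%N -> in_Kn n (x1 ^+ i * x2 ^+ j).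
  move=> lt_n; apply: (@iter_diff_eq0 _ sigma (i + j).+1 n) => //.
  apply: iter_diffM_eq0.
    by apply: (iter_diffX_eq0 ringA fixA sigma_x1); first exact: in_A_x3.
  by apply: (iter_diffX_eq0 ringA fixA sigma_x2); first exact: in_A_x4.
move: s; apply: S_ind => [//|kk i j _ ij|i j _ _ _].
  rewrite /in_Kn [Delta_pow _ _](@iter_diffZ _ sigma) ?rmorphXn ?sigma_u //.
  by rewrite [iter _ _ _]K_mono ?mulr0 //; lia.
by rewrite /in_Kn /Delta_pow -iterD subnKC //; exact: Delta_pow_p.
Qed.

(** * Spanning by [S] once [x3] is inverted *)

Lemma submodule_xu (L : P -> Prop) g N : submodule A L ->
  (forall i j, (i + j = N)%N -> L (g * (x1 ^+ i * x2 ^+ j))) ->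
  forall i j, (i + j = N)%N -> L (g * (x1 ^+ i * u ^+ j)).
Proof.
move=> subL Lx.
(* Factors [u] are expanded one at a time, each becoming [x1] or [x2] with a coefficient in [A]; the
   total degree in [x1], [x2] and [u] stays [N]. *)
suff Lxu j i l : (i + l + j = N)%N -> L (g * (x1 ^+ i * x2 ^+ l * u ^+ j)).
  by move=> i j ij; have := Lxu j i 0%N; rewrite expr0 mulr1 addn0; apply.
elim: j => [|j IH] in i l *; rewrite ?addn0 => ijl; first by rewrite expr0 mulr1; apply: Lx.
rewrite (_ : g * _ = x4 * (g * (x1 ^+ i.+1 * x2 ^+ l * u ^+ j))
                     - x3 * (g * (x1 ^+ i * x2 ^+ l.+1 * u ^+ j))).
  apply: (submoduleB ringA subL); apply: (submoduleZ subL);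
    first [exact: in_A_x4 | exact: in_A_x3 | apply: IH; lia].
by rewrite ![_ ^+ _.+1]exprS /u; ring.
Qed.

(** Expanding [(x1 * x4 - u) ^+ b] leaves, apart from the top power of [u], only terms with smaller
    exponent of [u]. *)
Lemma submodule_x2 (L : P -> Prop) a b : submodule A L ->
  (forall l m, (l < b)%N -> L (u ^+ l * x1 ^+ m)) ->
  L (x1 ^+ a * (x3 * x2) ^+ b - (- u) ^+ b * x1 ^+ a).
Proof.
move=> subL Lu; rewrite (_ : x3 * x2 = x1 * x4 + - u); last by rewrite /u; ring.
rewrite exprDn big_ord_recr /= subnn expr0 mul1r binn mulr1n mulrDr [X in _ + X - _]mulrC addrK.
rewrite big_distrr; apply: (submodule_sum subL) => /= l _.
rewrite (_ : _ * _ = ('C(b, l)%:R * (-1) ^+ l * x4 ^+ (b - l)) * (u ^+ l * x1 ^+ (a + (b - l)))).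
  apply: (submoduleZ subL); last exact: Lu (ltn_ord l).
  apply: subringM; [by [] | apply: subringM => // | exact: in_A_x4X].
    exact: subring_nat.
  exact: in_A_sign.
by rewrite -mulr_natl exprMn [(- u) ^+ _]exprNn exprD; ring.
Qed.

Lemma lowdeg_x1 m : lowdeg A x1 p (x1 ^+ m).
Proof.
have [L0 LD LZ] := lowdeg_submodule ringA x1 p.
have [b] := ubnP m; elim: b => // b IH in m *; rewrite ltnS => le_m.
have [lt_mp|le_pm] := ltnP m p; first exact: lowdegX.
rewrite -(subnK le_pm) exprD x1_p.
rewrite (_ : _ * _ = x3 ^+ p.-1 * x1 ^+ (m - p).+1 + N1 * x1 ^+ (m - p)).
  by apply: LD; apply: LZ; first [exact: in_A_x3X | exact: in_A_N1 | apply: IH; lia].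
by rewrite exprS; ring.
Qed.

Lemma lowdeg_Delta_pow r d f : lowdeg A x1 d f -> lowdeg A x1 (d - r) (iter r (diff sigma) f).
Proof.
move=> Lf; elim: r => [|r IH]; first by rewrite subn0.
rewrite subnS iterS.
exact: (diff_lowdeg ringA (sigma_A p_pr char_p) sigma_x1 (in_A_x3 _ _)).
Qed.

Lemma submodule_natr_cancel m (L : P -> Prop) f : m%:R != 0 :> P -> submodule A L -> L (m%:R * f) -> L f.
Proof.
rewrite -mpolyC_nat mpolyC_eq0 => m0 subL Lf; rewrite -[f]mul1r -mpolyC1 -(mulVf m0) mpolyCM.
by rewrite -mulrA; apply: (submoduleZ subL) => //; exact: in_AC.
Qed.

(** Induction on [j], then on [i]. The ranges [i + j < n], [n <= i + j < p] and [p <= i + j] are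
    served by [M], [U] and [D]; in the last one the lower terms fall to one of the two
    inductions. *)
Lemma locally_S i j : (i < n)%N -> (j < p)%N -> locally x3 (lspan A S0) (x1 ^+ i * u ^+ j).
Proof.
have fixA := sigma_A p_pr char_p.
have subS := submodule_lspan ringA S0.
have subL := submodule_locally ringA (in_A_x3 k p) subS.
elim/ltn_ind: j i => j IHj; elim/ltn_ind => i IHi lt_in lt_jp.
have [lt_ijn|le_nij] := ltnP (i + j) n.
  apply: locally_intro; rewrite -[_ * _]mul1r; apply: (submodule_xu subS) (erefl _) => i' j' ij.
  by rewrite mul1r; apply: mem_lspan => //; rewrite mem_cat mem_M // ij.
have [lt_ijp|le_pij] := ltnP (i + j) p.
  (* Taking out [u ^+ kk] leaves total degree [n.-1] in [x1] and [u], as in [U]; the range of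
     [i + j] gives [1 <= kk <= p - n]. *)
  pose kk := (i + j - n.-1)%N; apply: locally_intro.
  rewrite (_ : j = kk + (n.-1 - i))%N; last by lia.
  rewrite exprD mulrCA; apply: (submodule_xu (N := n.-1) subS) => [i' j' ij|]; last by lia.
  by apply: mem_lspan => //; rewrite !mem_cat mem_U ?orbT //; lia.
(* With this [a], [r] differences bring [x1 ^+ a] down to degree [i]; the bound [2 * p - n <= a + j]
   required by [D] is exactly [p <= i + j]. *)
pose r := (p - n)%N; pose a := (i + r)%N.
(* Used twice: with [l < j] and [d = n] for the outer induction, with [l = j] and [d = i] for the
   inner one. *)
have low_u l m d f : (forall i', (i' < d)%N -> locally x3 (lspan A S0) (x1 ^+ i' * u ^+ l)) ->
    lowdeg A x1 d f -> locally x3 (lspan A S0) ((- 1) ^+ m * u ^+ l * f).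
  move=> Ld; rewrite -mulrA; apply: (lspan_submodule (A := A)
    (L := fun f => locally x3 (lspan A S0) ((- 1) ^+ m * (u ^+ l * f)))).
    have [L0 LD LZ] := subL; split=> [|f1 f2|c f1 Ac]; rewrite ?mulr0 //.
      by rewrite !mulrDr; apply: LD.
    by rewrite [_ * (c * _)]mulrCA [(-1) ^+ _ * (c * _)]mulrCA; apply: LZ.
  move=> _ /mapP[i' lt_i' ->]; rewrite mem_iota in lt_i'.
  apply: (submoduleZ subL); last by rewrite mulrC; apply: Ld.
  exact: in_A_sign.
(* The invariant factor [x3 ^+ j] allows [x2 ^+ j] to be rewritten through [x1] and [u]. *)
have L_D : locally x3 (lspan A S0) (iter r (diff sigma) (x1 ^+ a * (x3 * x2) ^+ j)).
  rewrite exprMn mulrCA iter_diffZ; last exact/fixA/in_A_x3X.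
  apply: (submoduleZ subL); first exact: in_A_x3X.
  apply/locally_intro/mem_lspan => //; rewrite !mem_cat mem_D ?orbT //; lia.
have L_lead : locally x3 (lspan A S0) (iter r (diff sigma) ((- u) ^+ j * x1 ^+ a)).
  rewrite -[_ * _](subKr (x1 ^+ a * (x3 * x2) ^+ j)).
  have subL' := submodule_iter_diff fixA r subL.
  apply: (submoduleB ringA subL' L_D); apply: (submodule_x2 _ subL') => l m lt_lj.
  rewrite iter_diffZ ?rmorphXn ?sigma_u // -[u ^+ l]mul1r -(expr0 (-1)).
  apply: (low_u l 0 n) => [i' lt_i'|]; first by apply: IHj => //; exact: ltn_trans lt_jp.
  (* Any power of [x1] reduces to degree below [p], and [r] differences bring this below
     [p - r = n]. *)
  by have := lowdeg_Delta_pow r (lowdeg_x1 m); rewrite /r subKn.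
have fix_u : sigma ((- u) ^+ j) = (- u) ^+ j by rewrite rmorphXn rmorphN sigma_u.
rewrite iter_diffZ // exprNn in L_lead.
have le_ra : (r <= a)%N by rewrite /a leq_addl.
have lowd := iter_diffX ringA fixA sigma_x1 (in_A_x3 _ _) le_ra.
have ar : (a - r = i)%N by rewrite /a addnK.
rewrite ar in lowd.
have L_tail := low_u j j i _ (fun i' lt_i' => IHi i' lt_i' (ltn_trans lt_i' lt_in) lt_jp) lowd.
have := submoduleB ringA subL L_lead L_tail.
rewrite -mulrBr subKr => L_top.
(* The falling factorial divides [a!], which is prime to [p] because [a < p]. *)
have a_neq0 : (a ^_ r)%:R != 0 :> P.
  have lt_ap : (a < p)%N by rewrite /a /r; lia.
  have := fact_neq0 char_P lt_ap; rewrite -(ffact_fact le_ra) natrM mulf_eq0 negb_or.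
  by case/andP.
apply: (submodule_natr_cancel a_neq0 subL); apply: (locally_div (e := r)).
rewrite (_ : _ * _ = (-1) ^+ j * ((-1) ^+ j * u ^+ j * ((a ^_ r)%:R * x3 ^+ r * x1 ^+ i))).
  by apply: (submoduleZ subL) => //; exact: in_A_sign.
by rewrite !mulrA -expr2 sqrr_sign mul1r; ring.
Qed.

(** * Independence, the symmetry, and removal of denominators *)

Lemma indep_S : indep A S0.
Proof.
apply: (indep_transfer ringA (in_A_x3 _ _) (x3_neq0 _) _ (indep_monos_x1u le_np)).
- by rewrite size_S size_mkseq.
- by move=> _ /(monosP p_gt1)[i [j [lt_in lt_jp ->]]]; apply: locally_S.
- by move=> s /in_Kn_S; apply: in_Kn_locally.
Qed.

Lemma locally_x3_S f : in_Kn n f -> locally x3 (lspan A S0) f.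
Proof.
move=> /(in_Kn_locally le_np)[e Lf]; apply: (locally_div (e := e)).
have subL := submodule_locally ringA (in_A_x3 k p) (submodule_lspan ringA S0).
apply: (lspan_submodule subL _ Lf) => _ /(monosP p_gt1)[i [j [lt_in lt_jp ->]]].
exact: locally_S.
Qed.

(** [swap] preserves [A], commutes with the difference operator and sends [u] to [- u], so it
    permutes the family up to signs. *)
Lemma swap_S f : lspan A S0 f -> lspan A S0 (swap f).
Proof.
have subS := submodule_lspan ringA S0.
have swap_mono i j : swap (x1 ^+ i * x2 ^+ j) = x1 ^+ j * x2 ^+ i.
  by rewrite rmorphM !rmorphXn /= !substE mulrC.
apply: (lspan_submodule (A := A) (L := fun f => lspan A S0 (swap f))).
  have [L0 LD LZ] := subS; split=> [|g h Lg Lh|a g Aa Lg]; first by rewrite rmorph0.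
    by rewrite rmorphD; apply: LD.
  by rewrite rmorphM; apply: LZ => //; apply: swap_A.
apply: S_ind => [i j lt_ij|kk i j le_kk ij|i j lt_ip lt_jp le_ij].
- by rewrite swap_mono; apply: mem_lspan => //; rewrite mem_cat mem_M // addnC.
- rewrite rmorphM swap_mono rmorphXn swap_u exprNn -mulrA; apply: (submoduleZ subS).
    exact: in_A_sign.
  by apply: mem_lspan => //; rewrite !mem_cat mem_U ?orbT // addnC.
- rewrite swap_Delta_pow swap_mono; apply: mem_lspan => //.
  by rewrite !mem_cat mem_D ?orbT // addnC.
Qed.

Lemma locally_x4_S f : in_Kn n f -> locally x4 (lspan A S0) f.
Proof.
move=> Kf; have Kswap : in_Kn n (swap f) by rewrite /in_Kn -swap_Delta_pow Kf rmorph0.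
have [e /swap_S] := locally_x3_S Kswap; rewrite rmorphM rmorphXn swapK /= substE.
by exists e.
Qed.

(** Independence turns the expansions of [x3 ^+ e * f] and [x4 ^+ d * f] into
    [x4 ^+ d * a i = x3 ^+ e * b i]. So [x3 ^+ e] divides [a i], and the quotient lies in [A] by
    [in_A_div]. *)
Lemma lspan_S f : in_Kn n f -> lspan A S0 f.
Proof.
move=> Kf; have [e [a [Aa Ea]]] := locally_x3_S Kf; have [d [b [Ab Eb]]] := locally_x4_S Kf.
have ab i : (i < size S0)%N -> x4 ^+ d * a i = x3 ^+ e * b i.
  move=> lt_i; apply/eqP; rewrite -subr_eq0; apply/eqP.
  apply: (indep_S (c := fun i => x4 ^+ d * a i - x3 ^+ e * b i)) lt_i => [j|].
    by apply: subringB => //; apply: subringM => //; [exact: in_A_x4X | exact: in_A_x3X].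
  under eq_bigr do rewrite mulrBl -!mulrA.
  by rewrite sumrB -!big_distrr /= -Ea -Eb mulrCA subrr.
have /fin_all_exists[c cP] (i : 'I_(size S0)) : exists c, A c /\ a i = x3 ^+ e * c.
  have [c Ec] := x3_dvd (ab i (ltn_ord i)); exists c; split=> //.
  by apply: (in_A_div (e := e)); rewrite -Ec.
exists (fun m => oapp c 0 (insub m)); split=> [m|].
  by case: insub => [i|] /=; [case: (cP i) | exact: (subring0 ringA)].
apply: (mulfI (expf_neq0 e (x3_neq0 k))); rewrite Ea big_distrr /=.
by apply: eq_bigr => i _; case: (cP i) => _ ->; rewrite valK /= mulrA.
Qed.

End KernelBasis.

Theorem theorem4p16 (p : nat) (k : fieldType) (n : nat) :
  prime p -> (p \in [pchar k])%R -> (1 <= n <= p)%N ->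
  @free_A_basis k p n (@S_basis k p n).
Proof.
move=> p_pr char_p n_le.
have indS := indep_S p_pr char_p n_le.
(* Independence rules out repetitions, so the concatenated list is already the union as a set. *)
rewrite /S_basis undup_id; last exact: indep_uniq (subring_in_A k p) _ indS.
split=> //.
- by move=> s; apply: in_Kn_S.
- by move=> f; apply: lspan_S.
Qed.
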